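(* Let $X\subset\mathcal L$, $n\ge1$, $\alpha\in(0,1)$, and let $\epsilon_1,\dots,\epsilon_n$ be independent real random variables with mean zero such that for some $\kappa>0$, $v>0$ and all integers $m\ge2$ one has $\mathbb E|\epsilon_i|^m\le v\,m!\,\kappa^{m-2}/2$ for all $i$. Let $$\tau_n(\alpha):=\frac1n\left(\sqrt{\log(\alpha/2)\left(\log(\alpha/2)\kappa^2-2nv\right)}-\kappa\log(\alpha/2)\right).$$ For $f\in X$ let $Y_i=f\left(\frac{i-1}{n}\right)+\epsilon_i$, $i=1,\dots,n$. Then $$\inf_{f\in X}\mathbb P\left(s_j(f^{(n)})\in\left[\left(s_j(Y^{(n)})-\tau_n(\alpha)\right)_+,\ s_j(Y^{(n)})+\tau_n(\alpha)\right]\ \text{for all } j\in\mathbb N_0\right)\ge 1-\alpha,$$ where $(x)_+=\max(0,x)$.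
   Context: $\mathcal L^\infty$ is the space of Lebesgue-measurable essentially bounded functions $[0,1]\to\mathbb R$ (genuine functions, not equivalence classes). With $t^-(\delta)=\max(0,t-\delta)$, $t^+(\delta)=\min(1,t+\delta)$, let $\mathcal L$ be the set of $f\in\mathcal L^\infty$ with $f(t)=\lim_{\epsilon\to0}\inf_{0<\delta<\epsilon}\frac{1}{t^+(\delta)-t^-(\delta)}\int_{t^-(\delta)}^{t^+(\delta)}f(s)\,ds$ for all $t\in[0,1]$ (each a.e.-class in $\mathcal L^\infty$ has exactly one representative in $\mathcal L$). The Kolmogorov distance is $d_K(f,g)=\sup_{x\in[0,1]}\left|\int_0^x (f(s)-g(s))\,ds\right|$. Number of modes: for $g:[0,1]\to\mathbb R$ and a partition $P$: $0=t_0<\dots<t_{N}=1$, let $M(g,P)$ be the number of indices $0<i<N$ with $\max(g(t_{i-1}),g(t_{i+1}))<g(t_i)$, and let $M(g)=\sup_P M(g,P)$ over all finite partitions. For $n\ge1$ let $PC_n$ be the set of $g\in\mathcal L$ that are constant on each open interval $\left(\frac{i-1}{n},\frac in\right)$, $i=1,\dots,n$. Let $X^{(n)}_j=\{g\in PC_n: M(g)\le j\}$, and for $g\in PC_n$ let $s_j(g)=\inf_{h\in X_j^{(n)}}d_K(g,h)$, $j\in\mathbb N_0$. Let $f^{(n)}\in PC_n$ be the function with value $f\left(\frac{i-1}{n}\right)$ on $\left(\frac{i-1}{n},\frac in\right)$, and $Y^{(n)}\in PC_n$ the (random) function with value $Y_i$ on $\left(\frac{i-1}{n},\frac in\right)$,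 $i=1,\dots,n$. *)

(* Defs.v *)
From HB Require Import structures.
From mathcomp Require Import all_boot all_order all_algebra.
From mathcomp Require Import all_classical all_reals all_analysis.

Set Implicit Arguments.
Unset Strict Implicit.
Unset Printing Implicit Defensive.

Import Order.TTheory GRing.Theory Num.Theory.
Import numFieldNormedType.Exports.

Local Open Scope classical_set_scope.
Local Open Scope ring_scope.

(* Functions on [0, 1] are represented by functions R -> R; every notion below
   depends only on their values on [0, 1]. *)

Section function_classes.
Context {R : realType}.
Implicit Types (f g h : R -> R) (t d x : R) (n j : nat).

(* The completed measure makes measurability and integration those of
   Lebesgue, rather than those of Borel functions. *)
Notation mu := (@completed_lebesgue_measure R).

Notation lebesgueR :=
  (caratheodory_type (wlength (@idfun R))^*%mu).

Definition Linfty : set (R -> R) :=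
  [set f : R -> R | measurable_fun (`[0, 1]%classic : set lebesgueR) f /\
     exists M : R, {ae mu, forall t, t \in `[0, 1] -> `|f t| <= M}].

Definition tminus t d : R := Num.max 0 (t - d).
Definition tplus t d : R := Num.min 1 (t + d).

Definition local_avg f t d : R :=
  (\int[mu]_(s in `[tminus t d, tplus t d]) f s) / (tplus t d - tminus t d).

Definition calL : set (R -> R) :=
  [set f | Linfty f /\
     forall t, t \in `[0, 1] ->
       inf [set local_avg f t d | d in `]0, e[%classic] @[e --> 0^'+] --> f t].

Definition dK f g : R :=
  sup [set `|\int[mu]_(s in `[0, x]) (f s - g s)| | x in `[0, 1]%classic].

(* The partition t_0 < ... < t_N is 0 :: s, with N = size s. *)
Definition modes_on g (s : seq R) : nat :=
  let t := nth 0 (0 :: s) in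
  \sum_(1 <= i < size s | Num.max (g (t i.-1)) (g (t i.+1)) < g (t i)) 1.

Definition modes g : \bar R :=
  ereal_sup [set (modes_on g s)%:R%:E | s in itv_partition 0 1].

(* For i : 'I_n, this is the (i+1)-st interval of the mesh of width 1/n. *)
Definition cell n (i : 'I_n) : set R := `](i%:R / n%:R), (i.+1%:R / n%:R)[.

Definition PC n : set (R -> R) :=
  [set g | calL g /\ forall i : 'I_n, exists c, forall t, cell i t -> g t = c].

(* On [0, 1] there is exactly one such g: membership in calL determines its
   values at the endpoints of the cells. *)
Definition pc_fun n (y : 'I_n -> R) : R -> R :=
  xget (cst 0) [set g | PC n g /\
                        forall (i : 'I_n) t, cell i t -> g t = y i].

Definition Xmodes n j : set (R -> R) :=
  [set g | PC n g /\ (modes g <= j%:R%:E)%E].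

Definition modal_dist n j g : R := inf [set dK g h | h in Xmodes n j].

Definition tau n (kappa v alpha : R) : R :=
  n%:R^-1 * (Num.sqrt (ln (alpha / 2) *
                       (ln (alpha / 2) * kappa ^+ 2 - 2 * n%:R * v))
             - kappa * ln (alpha / 2)).

End function_classes.

Definition mutually_independent d (T : measurableType d) (R : realType)
    (P : probability T R) (I : finType) (X : I -> {RV P >-> R}) : Prop :=
  forall (J : {set I}) (A : I -> set R), (forall i, measurable (A i)) ->
    P (\bigcap_(i in [set` J]) (X i @^-1` A i)) =
    (\prod_(i in J) P (X i @^-1` A i))%E.

Arguments mutually_independent {d T R} P {I} X.

(* Main.v *)
(* The map g |-> s_j(g) is 1-Lipschitz for d_K, and by Abel summation the distance
   of two step functions on the mesh is at most 1/n times the largest absolute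
   partial sum of the differences of their values. So it suffices to bound the
   partial sums of the noise, uniformly, by n * tau, which is Bernstein's maximal
   inequality: stop the partial sums as soon as they leave [-x, x]; the stopped sum
   is independent of the next noise variable, so its exponential moment grows by at
   most one factor M = exp(l^2 v / (2 (1 - l kappa))) per step, and Chernoff's bound
   at the final time controls the maximum.

   P is only constrained on measurable sets, so the event has to be shown measurable:
   s_j(Y^(n)) is a Lipschitz function of the noise vector. *)

Require Import Defs.
From HB Require Import structures.
From mathcomp Require Import all_boot all_order all_algebra.
From mathcomp Require Import all_classical all_reals all_analysis.
From mathcomp Require Import measurable_realfun.
From mathcomp Require Import ring lra.

Set Implicit Arguments.
Unset Strict Implicit.
Unset Printing Implicit Defensive.

Import Order.TTheory GRing.Theory Num.Theory.
Import numFieldNormedType.Exports.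

Local Open Scope classical_set_scope.
Local Open Scope ring_scope.

(** * Step functions on the mesh *)

Section step_functions.
Context {R : realType}.
Implicit Types (f g h : R -> R) (t d x : R) (n j : nat).

Notation mu := (@completed_lebesgue_measure R).
Notation lebesgueR := (caratheodory_type (wlength (@idfun R))^*%mu).

Lemma borel_lebesgue_measurable (A : set R) :
  measurable A -> measurable (A : set lebesgueR).
Proof. exact: sub_caratheodory. Qed.

Lemma itv_lebesgue_measurable (i : interval R) :
  measurable ([set` i] : set lebesgueR).
Proof. by apply: borel_lebesgue_measurable; exact: measurable_itv. Qed.

(** Completion enlarges the sigma-algebra but not the underlying set function, so the known value
    for Borel sets transfers by conversion. *)
Lemma completed_lebesgue_measure_itv (i : interval R) :
  mu [set` i] = (if i.1 < i.2 then (i.2 : \bar R) - i.1 else 0)%E.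
Proof. by rewrite -lebesgue_measure_itv. Qed.

Lemma completed_lebesgue_measure_bounded_itv (a b : R) (u v : bool) : a <= b ->
  mu [set` Interval (BSide u a) (BSide v b)] = (b - a)%:E.
Proof.
rewrite le_eqVlt completed_lebesgue_measure_itv /= lte_fin => /predU1P[->|->//].
by rewrite ltxx subrr.
Qed.

Lemma Rintegral_sum_indic (D : set R) (I : finType) (c : I -> R)
    (A : I -> set R) :
  measurable (D : set lebesgueR) -> (mu D < +oo)%E ->
  (forall i, measurable (A i : set lebesgueR)) ->
  \int[mu]_(s in D) (\sum_i c i * \1_(A i) s) =
  \sum_i c i * fine (mu (A i `&` D)).
Proof.
move=> mD Doo mA.
have iA i : mu.-integrable D (fun s => (\1_(A i) s)%:E).
  apply: measurable_bounded_integrable => //.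
  exists 1; split=> // M M1 s Ds /=; rewrite ger0_norm// indicE.
  by case: (_ \in _); rewrite ?ltW// (lt_trans ltr01).
rewrite /Rintegral.
under eq_integral do rewrite -sumEFin.
rewrite integral_sum//; last first.
  by move=> i; under eq_fun do rewrite EFinM; exact: integrableZl.
rewrite -sum_fine; last first.
  move=> i _; under eq_integral do rewrite EFinM.
  rewrite integralZl// integral_indic// fin_numM// ge0_fin_numE//.
  by rewrite (le_lt_trans _ Doo)// le_measure// inE//; exact: measurableI.
apply: eq_bigr => i _.
under eq_integral do rewrite EFinM.
rewrite integralZl// integral_indic// fineM//.
by rewrite ge0_fin_numE// (le_lt_trans _ Doo)// le_measure// inE//;
  exact: measurableI.
Qed.

Lemma tminus_lt_tplus t d : 0 <= t <= 1 -> 0 < d -> tminus t d < tplus t d.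
Proof.
move=> /andP[t0 t1] d0; rewrite /tminus /tplus.
by rewrite gt_max !lt_min; apply/andP; split; apply/andP; split; lra.
Qed.

(** [b = true] is the closed interval and [b = false] the open one. The intersection is an interval
    whose endpoint types depend on [b], which the measure does not see. *)
Lemma completed_lebesgue_measure_itvI (b : bool) (lo hi p q : R) :
  mu ([set` Interval (BSide b lo) (BSide (~~ b) hi)] `&` `[p, q]) =
  (Num.max 0 (Num.min hi q - Num.max lo p))%:E.
Proof.
have mE (u v : bool) (a c : R) :
    mu [set` Interval (BSide u a) (BSide v c)] = (Num.max 0 (c - a))%:E.
  rewrite completed_lebesgue_measure_itv /= lte_fin.
  have [ac|ca] := ltP a c; first by rewrite max_r// subr_ge0 ltW.
  by rewrite max_l// subr_le0.
rewrite (_ : _ `&` _ = [set` Interval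
  (if lo < p then BLeft p else BSide b lo)
  (if q < hi then BRight q else BSide (~~ b) hi)]); last first.
  apply/seteqP; split=> s; case: ltP => lop; case: ltP => qhi; case: b;
    rewrite /= !in_itv/=;
    first [by move=> [/andP[? ?] /andP[? ?]]; apply/andP; split; lra
          |by move=> /andP[? ?]; split; apply/andP; split; lra].
by have [lop|lop] := ltP lo p; have [qhi|qhi] := ltP q hi; rewrite mE.
Qed.

(** A small window around [t] misses the interval, lies inside it, or is centred at an endpoint. In
    the last case half of it is covered, twice, while only the closed indicator counts [t]; the last
    hypothesis keeps this window from being clipped by [[0, 1]]. *)
Lemma near_itv_avg (lo hi t : R) : lo < hi -> 0 <= t <= 1 ->
  (t = lo \/ t = hi -> 0 < t < 1) ->
  \forall e \near 0^'+, forall d, 0 < d < e ->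
    \sum_(b : bool) fine (mu ([set` Interval (BSide b lo) (BSide (~~ b) hi)]
                              `&` `[tminus t d, tplus t d]))
    = (\sum_(b : bool) \1_[set` Interval (BSide b lo) (BSide (~~ b) hi)] t)
      * (tplus t d - tminus t d).
Proof.
move=> lohi t01 tb.
have interior d : 0 < t < 1 -> 0 < d -> d < t -> d < 1 - t ->
    tminus t d = t - d /\ tplus t d = t + d.
  by move=> *; rewrite /tminus /tplus; split; [rewrite max_r|rewrite min_r]; lra.
have le_tm d : t - d <= tminus t d by rewrite /tminus le_max lexx orbT.
have le_tp d : tplus t d <= t + d by rewrite /tplus ge_min lexx orbT.
(* The open and the closed interval cover equal lengths of the window, whence the factor 2. *)
suff : \forall e \near 0^'+, forall d, 0 < d < e ->
    (Num.max 0 (Num.min hi (tplus t d) - Num.max lo (tminus t d))) *+ 2 =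
    (\sum_(b : bool) \1_[set` Interval (BSide b lo) (BSide (~~ b) hi)] t)
      * (tplus t d - tminus t d).
  apply: filterS => e H d /H <-; rewrite big_bool.
  by rewrite !completed_lebesgue_measure_itvI.
rewrite !big_bool /= !indicE !mem_setE !in_itv /=.
have [tlo|lot|elo] := ltgtP t lo.
- near=> e => d /andP[d0 de]; rewrite addr0 mul0r.
  have dt : d < lo - t.
    by rewrite (lt_trans de)//; near: e; apply: nbhs_right_lt; rewrite subr_gt0.
  rewrite max_l ?mul0rn// subr_le0 ge_min; apply/orP; right.
  by rewrite le_max; apply/orP; left; rewrite (le_trans (le_tp d))// -lerBrDl ltW.
- have [thi|hit|ehi] := ltgtP t hi.
  + near=> e => d /andP[d0 de].
    have dt : d < t - lo.
      by rewrite (lt_trans de)//; near: e; apply: nbhs_right_lt; rewrite subr_gt0.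
    have dt' : d < hi - t.
      by rewrite (lt_trans de)//; near: e; apply: nbhs_right_lt; rewrite subr_gt0.
    have tptm := tminus_lt_tplus t01 d0.
    rewrite min_r; last by rewrite (le_trans (le_tp d))// -lerBrDl ltW.
    rewrite (max_r (x := lo)); last first.
      by rewrite (le_trans _ (le_tm d))// lerBrDr -lerBrDl ltW.
    by rewrite max_r ?subr_ge0 ?(ltW tptm)// mulr2n mulrDl mul1r.
  + near=> e => d /andP[d0 de]; rewrite addr0 mul0r.
    have dt : d < t - hi.
      by rewrite (lt_trans de)//; near: e; apply: nbhs_right_lt; rewrite subr_gt0.
    rewrite max_l ?mul0rn// subr_le0 ge_min; apply/orP; left.
    rewrite le_max; apply/orP; right.
    by rewrite (le_trans _ (le_tm d))// lerBrDr -lerBrDl ltW.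
  + have /andP[t0 t1] : 0 < t < 1 by apply: tb; right.
    near=> e => d /andP[d0 de].
    have dt : d < t by rewrite (lt_trans de)//; near: e; apply: nbhs_right_lt.
    have dt1 : d < 1 - t.
      by rewrite (lt_trans de)//; near: e; apply: nbhs_right_lt; rewrite subr_gt0.
    have dt' : d < t - lo.
      by rewrite (lt_trans de)//; near: e; apply: nbhs_right_lt; rewrite subr_gt0.
    have [||||-> ->] := interior d => //; first by rewrite t0.
    rewrite -ehi min_l ?lerDl ?ltW// (max_r (y := t - d)); last first.
      by rewrite lerBrDr -lerBrDl ltW.
    by rewrite max_r /=; lra.
- have /andP[t0 t1] : 0 < t < 1 by apply: tb; left.
  have thi : t < hi by rewrite elo.
  rewrite thi (ltW thi) /=.
  near=> e => d /andP[d0 de].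
  have dt : d < t by rewrite (lt_trans de)//; near: e; apply: nbhs_right_lt.
  have dt1 : d < 1 - t.
    by rewrite (lt_trans de)//; near: e; apply: nbhs_right_lt; rewrite subr_gt0.
  have dt' : d < hi - t.
    by rewrite (lt_trans de)//; near: e; apply: nbhs_right_lt; rewrite subr_gt0.
  have [||||-> ->] := interior d => //; first by rewrite t0.
  rewrite -elo min_r; last by rewrite -lerBrDl ltW.
  rewrite (max_l (x := t)); last by rewrite lerBlDr lerDl ltW.
  by rewrite max_r /=; lra.
Unshelve. all: end_near. Qed.

(* The outer intervals stick out of [0, 1]: at t = 0 and t = 1 the local averages
   are one-sided, so the indicators should see these points as interior. *)
Definition mesh_itv n (i : 'I_n) (b : bool) : interval R :=
  Interval (BSide b (if i == 0 :> nat then -1 else i%:R / n%:R))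
           (BSide (~~ b) (if i.+1 == n then 2 else i.+1%:R / n%:R)).

(* Half the sum of the indicators of the open and the closed interval is the
   indicator normalised to take the midpoint value at jumps. *)
Definition step_fun n (y : 'I_n -> R) (t : R) : R :=
  \sum_(p : 'I_n * bool) (y p.1 / 2) * \1_[set` mesh_itv p.1 p.2] t.

Lemma mesh_le n (a b : nat) : (a <= b)%N -> a%:R / n%:R <= b%:R / n%:R :> R.
Proof. by move=> ab; rewrite ler_wpM2r ?invr_ge0// ler_nat. Qed.

Lemma mesh_lt n (a b : nat) : (0 < n)%N -> (a < b)%N ->
  a%:R / n%:R < b%:R / n%:R :> R.
Proof. by move=> n0 ab; rewrite ltr_pM2r ?ltr_nat// invr_gt0 ltr0n. Qed.

Lemma mesh_ge0 n (a : nat) : 0 <= a%:R / n%:R :> R.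
Proof. by rewrite divr_ge0. Qed.

Lemma mesh_le1 n (a : nat) : (a <= n)%N -> a%:R / n%:R <= 1 :> R.
Proof.
move=> an; have [->|n0] := posnP n; first by rewrite invr0 mulr0.
by rewrite ler_pdivrMr ?ltr0n// mul1r ler_nat.
Qed.

(** The midpoint normalisation makes averages over small windows exact, not just convergent; this
    reduces to [near_itv_avg] on each mesh interval. *)
Lemma step_fun_avg n (y : 'I_n -> R) (t : R) : 0 <= t <= 1 ->
  \forall e \near 0^'+, forall d, 0 < d < e ->
    local_avg (step_fun y) t d = step_fun y t.
Proof.
move=> t01; have /andP[t0 t1] := t01.
have avg (i : 'I_n) : \forall e \near 0^'+, forall d, 0 < d < e ->
    \sum_(b : bool) fine (mu ([set` mesh_itv i b]
                              `&` `[tminus t d, tplus t d]))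
    = (\sum_(b : bool) \1_[set` mesh_itv i b] t) * (tplus t d - tminus t d).
  have n0 : (0 < n)%N by rewrite (leq_trans _ (ltn_ord i)).
  apply: near_itv_avg => //.
    have := mesh_lt n0 (leqnn i.+1); have := mesh_ge0 n i.
    have := mesh_le1 (ltn_ord i).
    by case: ifPn; case: ifPn => *; lra.
  (* An endpoint equal to [t] cannot be -1 or 2, so it is a mesh point strictly between 0 and 1. *)
  case; case: ifPn => [_ te|bd te]; try lra; rewrite te.
    have i0 : (0 < i)%N by rewrite lt0n.
    by rewrite divr_gt0 ?ltr0n//= ltr_pdivrMr ?ltr0n// mul1r ltr_nat.
  rewrite divr_gt0 ?ltr0n//= ltr_pdivrMr ?ltr0n// mul1r ltr_nat.
  by rewrite ltn_neqAle bd ltn_ord.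
apply: filterS (filter_forall _ avg) => e avge d de; rewrite /local_avg.
have lt_t := tminus_lt_tplus t01 (andP de).1.
have mI (p : 'I_n * bool) :
    measurable ([set` mesh_itv p.1 p.2] : set lebesgueR).
  exact: itv_lebesgue_measurable.
rewrite Rintegral_sum_indic//; last 2 first.
  exact: itv_lebesgue_measurable.
  by rewrite completed_lebesgue_measure_bounded_itv ?ltry// ltW.
rewrite -(pair_bigA _ (fun i b => y i / 2 *
  fine (mu ([set` mesh_itv i b] `&` `[tminus t d, tplus t d])))) /=.
rewrite /step_fun -(pair_bigA _ (fun i b => y i / 2 * \1_[set` mesh_itv i b] t)).
rewrite mulr_suml; apply: eq_bigr => i _.
rewrite -!mulr_sumr avge//; field.
by rewrite subr_eq0 gt_eqF.
Qed.

Lemma step_fun_cell n (y : 'I_n -> R) (i : 'I_n) (t : R) :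
  cell i t -> step_fun y t = y i.
Proof.
rewrite /cell /= in_itv /= => /andP[it ti].
have n0 : (0 < n)%N by rewrite (leq_trans _ (ltn_ord i)).
have ge0 := mesh_ge0 n i; have le1 := mesh_le1 (ltn_ord i).
rewrite /step_fun -(pair_bigA _ (fun i b => y i / 2 * \1_[set` mesh_itv i b] t)).
rewrite (bigD1 i)//= [X in _ + X]big1 ?addr0 => [|j ji].
  rewrite -mulr_sumr big_bool /= !indicE !mem_set ?divfK//=.
    by rewrite in_itv/=; case: ifPn => _; case: ifPn => _; apply/andP; split; lra.
  by rewrite in_itv/=; case: ifPn => _; case: ifPn => _; apply/andP; split; lra.
rewrite -mulr_sumr big_bool /= !indicE.
have notin (lo hi : R) (u w : bool) : t < lo \/ hi < t ->
    t \notin Interval (BSide u lo) (BSide w hi).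
  by case: u w => -[] out; rewrite in_itv /=; apply/negP => /andP[? ?]; lra.
suff out : t < (if j == 0 :> nat then -1 else j%:R / n%:R) \/
      (if j.+1 == n then 2 else j.+1%:R / n%:R) < t.
  by rewrite !mem_setE !(negbTE (notin _ _ _ _ _)) ?addr0 ?mulr0//.
move: ji; rewrite neq_lt => /orP[ji|ij]; [right|left].
  rewrite ifF; first by rewrite (le_lt_trans _ it)// mesh_le.
  by apply/negbTE; rewrite neq_ltn (leq_ltn_trans _ (ltn_ord i)).
rewrite ifF; first by rewrite (lt_le_trans ti)// mesh_le.
by apply/negbTE; rewrite -lt0n (leq_ltn_trans _ ij).
Qed.

Lemma step_fun_PC n (y : 'I_n -> R) : PC n (step_fun y).
Proof.
have mI (p : 'I_n * bool) :
    measurable ([set` mesh_itv p.1 p.2] : set lebesgueR).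
  exact: itv_lebesgue_measurable.
split; last by move=> i; exists (y i) => t; exact: step_fun_cell.
split; last first.
  move=> t; rewrite in_itv /= => t01; apply: cvg_near_cst.
  (* For small [e] all averages coincide, so the infimum is taken over a singleton. *)
  near=> e; rewrite (_ : [set _ | _ in _] = [set step_fun y t]) ?inf1//.
  have e0 : 0 < e by near: e; exact: nbhs_right_gt.
  have avge : forall d, 0 < d < e -> local_avg (step_fun y) t d = step_fun y t.
    by near: e; exact: step_fun_avg.
  apply/seteqP; split=> [_ [d] /= + <-|_ ->]; first by rewrite in_itv; exact: avge.
  exists (e / 2); last by apply: avge; lra.
  by rewrite /= in_itv/=; lra.
split.
  by apply: measurable_sum => p; exact: measurable_funM.
exists (\sum_(p : 'I_n * bool) `|y p.1 / 2|); apply: aeW => t _.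
rewrite (le_trans (ler_norm_sum _ _ _))// ler_sum// => p _.
rewrite normrM indicE; case: (_ \in _); rewrite ?normr0 ?normr1 ?mulr1 ?mulr0//.
Unshelve. all: end_near. Qed.

(** [step_fun y] inhabits the set from which [pc_fun] chooses, so the default value of [xget] never
    occurs. *)
Lemma pc_fun_spec n (y : 'I_n -> R) :
  PC n (pc_fun y) /\ forall (i : 'I_n) t, cell i t -> pc_fun y t = y i.
Proof.
rewrite /pc_fun; set S := [set g | _].
suff : exists g, S g by move=> /xgetPex -/(_ (cst 0)).
by exists (step_fun y); split; [exact: step_fun_PC|exact: step_fun_cell].
Qed.

End step_functions.

(** * The Kolmogorov distance between step functions *)

Section kolmogorov_distance.
Context {R : realType}.
Implicit Types (f g h : R -> R) (t d x : R) (n j : nat).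

Notation mu := (@completed_lebesgue_measure R).
Notation lebesgueR := (caratheodory_type (wlength (@idfun R))^*%mu).

Lemma cell_exists n (s : R) : (0 < n)%N -> 0 <= s <= 1 ->
  ~ [set k%:R / n%:R | k in [set: nat]] s -> exists i : 'I_n, cell i s.
Proof.
move=> n0 /andP[s0 s1] sG.
have nR0 : 0 < n%:R :> R by rewrite ltr0n.
have /truncn_itv/andP[lek ltk] : 0 <= s * n%:R by rewrite mulr_ge0.
set k := Num.truncn _ in lek ltk.
have skn : s != k%:R / n%:R by apply/eqP => sk; apply: sG; exists k.
(* [n <= k] would force [s = 1], which is a mesh point. *)
have kn : (k < n)%N.
  rewrite ltnNge; apply/negP => nk.
  have : n%:R <= s * n%:R by rewrite (le_trans _ lek)// ler_nat.
  rewrite -[leLHS]mul1r ler_pM2r// => s1'.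
  by apply: sG; exists n => //; rewrite divff ?gt_eqF//; lra.
exists (Ordinal kn); rewrite /cell /= in_itv /=; apply/andP; split.
  by rewrite lt_neqAle eq_sym skn ler_pdivrMr.
by rewrite ltr_pdivlMr.
Qed.

Lemma cell_inj n (i j : 'I_n) (t : R) : cell i t -> cell j t -> i = j.
Proof.
rewrite /cell /= !in_itv /= => /andP[it ti] /andP[jt tj]; apply/val_inj/eqP.
have aux (k l : nat) : k%:R / n%:R < t -> t < l.+1%:R / n%:R -> (k <= l)%N.
  move=> kt tl; rewrite leqNgt; apply/negP => /mesh_le-/(_ R n) le.
  by have := lt_trans kt (lt_le_trans tl le); rewrite ltxx.
by rewrite /= eqn_leq !aux.
Qed.

Lemma sum_cell_indic n (c : 'I_n -> R) (i : 'I_n) (t : R) : cell i t ->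
  \sum_j c j * \1_(cell j) t = c i.
Proof.
move=> it; rewrite (bigD1 i)//= big1 => [|j /negP ji].
  by rewrite indicE mem_set// mulr1 addr0.
rewrite indicE memNset ?mulr0// => jt; apply: ji.
by rewrite (cell_inj it jt).
Qed.

(** The length of the part of cell [k] to the left of [x], indexed by [nat] so that it can serve as
    the weight sequence of an Abel summation. *)
Definition cell_overlap n (x : R) (k : nat) : R :=
  Num.max 0 (Num.min x (k.+1%:R / n%:R) - k%:R / n%:R).

Lemma measure_cell_overlap n (i : 'I_n) (x : R) :
  mu (cell i `&` `[0, x]) = (cell_overlap n x i)%:E.
Proof.
have n0 : (0 < n)%N by rewrite (leq_trans _ (ltn_ord i)).
have ge0 := mesh_ge0 n i : 0 <= i%:R / n%:R :> R.
have lt := mesh_lt n0 (ltnSn i) : _ < _ :> R.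
rewrite /cell /cell_overlap; move: (i%:R / _) (i.+1%:R / _) ge0 lt => a b a0 ab.
by rewrite (completed_lebesgue_measure_itvI false) (max_l a0) [Num.min b x]minC.
Qed.

(** The mesh points form a null set, and off them the integrand is a combination of cell
    indicators. *)
Lemma Rintegral_cells n (g h : R -> R) (y z : 'I_n -> R) (x : R) :
  (0 < n)%N -> calL g -> calL h ->
  (forall i t, cell i t -> g t = y i) -> (forall i t, cell i t -> h t = z i) ->
  0 <= x <= 1 ->
  \int[mu]_(s in `[0, x]) (g s - h s) =
  \sum_(i < n) (y i - z i) * cell_overlap n x i.
Proof.
move=> n0 [[mg _] _] [[mh _] _] gy hz x01.
transitivity (\int[mu]_(s in `[0, x])
    (\sum_(i < n) (y i - z i) * \1_(@cell R n i) s)).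
  rewrite /Rintegral; congr fine; apply: ae_eq_integral.
  - exact: itv_lebesgue_measurable.
  - apply/measurable_EFinP.
    have mgh : measurable_fun (`[0, 1]%classic : set lebesgueR) (g \- h).
      exact: measurable_funB.
    apply: measurable_funS mgh; first exact: itv_lebesgue_measurable.
    by move=> s /=; rewrite !in_itv/= => /andP[-> /le_trans]; apply; case/andP: x01.
  - apply/measurable_EFinP; apply: measurable_sum => i.
    by apply: measurable_funM => //; apply: measurable_indic;
      exact: itv_lebesgue_measurable.
  exists [set k%:R / n%:R | k in [set: nat]]; split.
  - apply: borel_lebesgue_measurable; apply: countable_measurable => //.
    exact: card_image_le.
  - by apply: countable_lebesgue_measure0; exact: card_image_le.
  move=> s /= sN; apply: contrapT => sG; apply: sN => s0x.
  have [|i si] := cell_exists n0 _ sG.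
    by move: s0x; rewrite /= in_itv/=; lra.
  by rewrite (sum_cell_indic _ si) (gy _ _ si) (hz _ _ si).
rewrite Rintegral_sum_indic//.
- by apply: eq_bigr => i _; rewrite measure_cell_overlap.
- exact: itv_lebesgue_measurable.
- by rewrite completed_lebesgue_measure_bounded_itv ?ltry//; lra.
- by move=> i; exact: itv_lebesgue_measurable.
Qed.

Lemma cell_overlap_ge0 n (x : R) k : 0 <= cell_overlap n x k.
Proof. by rewrite /cell_overlap le_max lexx. Qed.

Lemma cell_overlap_le n (x : R) k : cell_overlap n x k <= n%:R^-1.
Proof.
rewrite /cell_overlap ge_max invr_ge0 ler0n /= lerBlDr ge_min.
by rewrite -natr1 mulrDl mul1r addrC lexx orbT.
Qed.

(** Cells to the left of [x] are fully covered, at most one is covered in part, and those to the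
    right not at all. *)
Lemma cell_overlap_anti n (x : R) k :
  cell_overlap n x k.+1 <= cell_overlap n x k.
Proof.
rewrite /cell_overlap; have : 0 <= n%:R^-1 :> R by rewrite invr_ge0.
rewrite -!natr1 !mulrDl !mul1r; move: (n%:R^-1) => b b0; move: (k%:R * b) => a.
rewrite ge_max !le_max lexx /=; apply/orP; right.
have [xab|abx] := leP x (a + b); first by rewrite min_l; lra.
by rewrite lerBlDr ge_min; apply/orP; right; lra.
Qed.

(* By induction, the partial sum minus its boundary term (\sum_(i < k) e i) * w k
   is bounded by B * (w 0 - w k). *)
Lemma abel_bound (w e : nat -> R) (B : R) m :
  (forall k, 0 <= w k) -> (forall k, w k.+1 <= w k) ->
  (forall k, (k <= m)%N -> `|\sum_(i < k) e i| <= B) ->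
  `|\sum_(i < m) e i * w i| <= B * w 0.
Proof.
move=> w0 wS eB.
have B0 : 0 <= B by rewrite (le_trans _ (eB 0 _)).
suff : forall k, (k <= m)%N ->
    `|\sum_(i < k) e i * w i - (\sum_(i < k) e i) * w k| <= B * (w 0 - w k).
  move=> /(_ m (leqnn m)) H.
  rewrite -[X in `|X|](subrK ((\sum_(i < m) e i) * w m)).
  rewrite (le_trans (ler_normD _ _))// normrM (ger0_norm (w0 m)).
  have := ler_wpM2r (w0 m) (eB m (leqnn m)); move: H.
  by rewrite mulrBr; lra.
elim=> [_|k IH km]; first by rewrite !big_ord0 mul0r !subrr mulr0 normr0.
rewrite !big_ord_recr/=.
have -> : \sum_(i < k) e i * w i + e k * w k - (\sum_(i < k) e i + e k) * w k.+1
  = (\sum_(i < k) e i * w i - (\sum_(i < k) e i) * w k)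
    + (\sum_(i < k) e i + e k) * (w k - w k.+1) by ring.
rewrite (le_trans (ler_normD _ _))// normrM.
have dw : 0 <= w k - w k.+1 by rewrite subr_ge0.
have Bk : `|\sum_(i < k) e i + e k| <= B by have := eB _ km; rewrite big_ord_recr.
have := IH (ltnW km); have := ler_wpM2r dw Bk; rewrite (ger0_norm dw).
by rewrite !mulrBr; lra.
Qed.

Lemma weighted_cell_bound n (e : 'I_n -> R) (B x : R) : (0 < n)%N ->
  (forall k, (k <= n)%N -> `|\sum_(i < n | (i < k)%N) e i| <= B) ->
  `|\sum_(i < n) e i * cell_overlap n x i| <= B / n%:R.
Proof.
case: n e => // n e _ eB.
have B0 : 0 <= B by rewrite (le_trans _ (eB 0%N _)).
(* Extends the vector to a sequence on [nat]; this is why [n] is first made a successor. *)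
pose f k := e (inord k).
have -> : \sum_(i < n.+1) e i * cell_overlap n.+1 x i
        = \sum_(i < n.+1) f i * cell_overlap n.+1 x i.
  by apply: eq_bigr => i _; rewrite /f inord_val.
apply: le_trans (abel_bound (B := B) (cell_overlap_ge0 _ _) (cell_overlap_anti _ _) _) _.
- move=> k km; have := eB k km; rewrite (big_ord_widen _ f km).
  by rewrite (eq_bigr (fun i : 'I_n.+1 => f i))// => i _; rewrite /f inord_val.
- by rewrite ler_wpM2l// cell_overlap_le.
Qed.

(** Membership in [PC n] with the values named; [calL] supplies the measurability needed to
    integrate. *)
Definition cell_values n g (y : 'I_n -> R) :=
  calL g /\ forall i t, cell i t -> g t = y i.

Lemma PC_cell_values n g : PC n g -> exists y : 'I_n -> R, cell_values g y.
Proof. by case=> cg /choice[y gy]; exists y. Qed.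

Lemma pc_fun_cell_values n (y : 'I_n -> R) : cell_values (pc_fun y) y.
Proof. by have [[]] := pc_fun_spec y. Qed.

Lemma integral_le_prefix n g h (y z : 'I_n -> R) (B x : R) : (0 < n)%N ->
  cell_values g y -> cell_values h z ->
  (forall k, (k <= n)%N -> `|\sum_(i < n | (i < k)%N) (y i - z i)| <= B) ->
  0 <= x <= 1 -> `|\int[mu]_(s in `[0, x]) (g s - h s)| <= B / n%:R.
Proof.
move=> n0 [cg gy] [ch hz] yzB x01.
by rewrite (Rintegral_cells n0 cg ch gy hz x01) weighted_cell_bound.
Qed.

Lemma dK_le n g h (y z : 'I_n -> R) (B : R) : (0 < n)%N ->
  cell_values g y -> cell_values h z ->
  (forall k, (k <= n)%N -> `|\sum_(i < n | (i < k)%N) (y i - z i)| <= B) ->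
  dK g h <= B / n%:R.
Proof.
move=> n0 gy hz yzB; apply: ge_sup.
  by exists `|\int[mu]_(s in `[0, 0]) (g s - h s)|, 0; rewrite //= in_itv/= lexx ler01.
by move=> _ [x /= x01 <-]; exact: integral_le_prefix gy hz yzB _.
Qed.

(** [sup] of an unbounded set is a default value, so lower bounds on [dK] rest on this. *)
Lemma dK_has_ubound n g h (y z : 'I_n -> R) : (0 < n)%N ->
  cell_values g y -> cell_values h z ->
  has_ubound [set `|\int[mu]_(s in `[0, x]) (g s - h s)| | x in `[0, 1]%classic].
Proof.
move=> n0 gy hz; exists ((\sum_(i < n) `|y i - z i|) / n%:R) => _ [x /= x01 <-].
apply: integral_le_prefix gy hz _ _ => // k _.
rewrite (le_trans (ler_norm_sum _ _ _))// [leRHS](bigID (fun i : 'I_n => (i < k)%N)).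
by rewrite lerDl sumr_ge0.
Qed.

Lemma dK_ge n g h (y z : 'I_n -> R) (x : R) : (0 < n)%N ->
  cell_values g y -> cell_values h z -> 0 <= x <= 1 ->
  `|\int[mu]_(s in `[0, x]) (g s - h s)| <= dK g h.
Proof.
move=> n0 gy hz x01; apply: (ub_le_sup (dK_has_ubound n0 gy hz)).
by exists x => //=; rewrite in_itv.
Qed.

Lemma dK_ge0 n g h (y z : 'I_n -> R) : (0 < n)%N ->
  cell_values g y -> cell_values h z -> 0 <= dK g h.
Proof.
by move=> n0 gy hz; apply: le_trans (dK_ge n0 gy hz (x := 0) _); rewrite ?lexx/=.
Qed.

Lemma dK_sym n g h (y z : 'I_n -> R) : (0 < n)%N ->
  cell_values g y -> cell_values h z -> dK g h = dK h g.
Proof.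
move=> n0 gy hz; congr sup; apply/seteqP.
have swap u v (a b : 'I_n -> R) x : cell_values u a -> cell_values v b ->
    0 <= x <= 1 -> \int[mu]_(s in `[0, x]) (u s - v s)
                 = - \int[mu]_(s in `[0, x]) (v s - u s).
  move=> [cu ua] [cv vb] x01.
  rewrite (Rintegral_cells n0 cu cv ua vb x01) (Rintegral_cells n0 cv cu vb ua x01).
  by rewrite -sumrN; apply: eq_bigr => i _; rewrite -mulNr opprB.
split=> _ [x /= + <-]; rewrite in_itv/= => x01; exists x; rewrite //= ?in_itv//.
  by rewrite (swap _ _ _ _ _ gy hz x01) normrN.
by rewrite (swap _ _ _ _ _ gy hz x01) normrN.
Qed.

Lemma dK_triangle n g h k (y z w : 'I_n -> R) : (0 < n)%N ->
  cell_values g y -> cell_values h z -> cell_values k w ->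
  dK g k <= dK g h + dK h k.
Proof.
move=> n0 gy hz kw; apply: ge_sup.
  by exists `|\int[mu]_(s in `[0, 0]) (g s - k s)|, 0; rewrite //= in_itv/= lexx ler01.
move=> _ [x /= + <-]; rewrite in_itv/= => x01.
apply: le_trans (lerD (dK_ge n0 gy hz x01) (dK_ge n0 hz kw x01)).
move: gy hz kw => [cg gy] [ch hz] [ck kw].
rewrite (Rintegral_cells n0 cg ck gy kw x01) (Rintegral_cells n0 cg ch gy hz x01).
rewrite (Rintegral_cells n0 ch ck hz kw x01).
apply: le_trans (ler_normD _ _); rewrite -big_split /= le_eqVlt; apply/orP; left.
by apply/eqP; congr `|_|; apply: eq_bigr => i _; ring.
Qed.

Lemma modes_cst (c : R) : (modes (cst c) <= 0)%E.
Proof.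
apply: ge_ereal_sup => _ [s _ <-]; rewrite /modes_on big_pred0// => i.
by rewrite /= maxxx ltxx.
Qed.

(** The zero function is always a competitor. Lower bounds on [modal_dist] rest on this, since [inf]
    of the empty set is a default value. *)
Lemma Xmodes_nonempty n j : @Xmodes R n j !=set0.
Proof.
have E : step_fun (fun _ : 'I_n => 0) = cst 0 :> (R -> R).
  by apply/funext => t; rewrite /step_fun big1// => p _; rewrite mul0r mul0r.
exists (cst 0); split; first by rewrite -E; exact: step_fun_PC.
by rewrite (le_trans (modes_cst 0))// lee_fin.
Qed.

Lemma modal_dist_lbound n j g (y : 'I_n -> R) : (0 < n)%N -> cell_values g y ->
  lbound [set dK g h | h in Xmodes n j] 0.
Proof.
by move=> n0 gy _ [h [/PC_cell_values[z hz] _] <-]; exact: dK_ge0 gy hz.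
Qed.

Lemma modal_dist_ge0 n j g (y : 'I_n -> R) : (0 < n)%N -> cell_values g y ->
  0 <= modal_dist n j g.
Proof.
move=> n0 gy; apply: lb_le_inf (modal_dist_lbound n0 gy).
by have [h Xh] := Xmodes_nonempty n j; exists (dK g h), h.
Qed.

(** One half of the Lipschitz property: every competitor for [h] also competes for [g], at a cost of
    at most [dK g h] by the triangle inequality. *)
Lemma modal_dist_le n j g h (y z : 'I_n -> R) : (0 < n)%N ->
  cell_values g y -> cell_values h z ->
  modal_dist n j g <= dK g h + modal_dist n j h.
Proof.
move=> n0 gy hz; rewrite -lerBlDl; apply: lb_le_inf.
  by have [u Xu] := Xmodes_nonempty n j; exists (dK h u), u.
move=> _ [u Xu <-]; rewrite lerBlDl; have [/PC_cell_values[w uw] _] := Xu.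
apply: le_trans (dK_triangle n0 gy hz uw).
by apply: ge_inf; [exists 0; exact: modal_dist_lbound gy|exists u].
Qed.

Lemma distr_le_sym (a b c e : R) : a <= c + b -> b <= c + a -> c <= e ->
  `|a - b| <= e.
Proof. by move=> *; rewrite ler_norml; apply/andP; split; lra. Qed.

(** The deterministic core, used twice: with the noise as difference it gives the coverage, and with
    [B] an l1-distance it gives the measurability of the event. *)
Lemma modal_dist_close n j (y z : 'I_n -> R) (B : R) : (0 < n)%N ->
  (forall k, (k <= n)%N -> `|\sum_(i < n | (i < k)%N) (y i - z i)| <= B) ->
  `|modal_dist n j (pc_fun y) - modal_dist n j (pc_fun z)| <= B / n%:R.
Proof.
move=> n0 yzB; have py := pc_fun_cell_values y; have pz := pc_fun_cell_values z.
apply: distr_le_sym (dK_le n0 py pz yzB); first exact: modal_dist_le py pz.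
by rewrite (dK_sym n0 py pz); exact: modal_dist_le pz py.
Qed.

End kolmogorov_distance.

(** * Exponential moments under Bernstein's condition *)

Section bernstein_mgf.
Context {R : realType}.

(** After its first two terms, the exponential series is bounded termwise by absolute values. The
    right side lives in the extended reals, where the value [+oo] makes the bound trivial. *)
Lemma expR_taylor2_le (y : R) :
  ((expR y - 1 - y)%:E <=
   \sum_(0 <= m <oo) (`|y| ^+ m.+2 / m.+2`!%:R)%:E)%E.
Proof.
have ge0 (m : nat) : (0 <= (`|y| ^+ m.+2 / m.+2`!%:R)%:E)%E.
  by rewrite lee_fin divr_ge0.
have part k := nneseries_lim_ge (m := 0) k (fun m _ (_ : xpredT m) => ge0 m).
move: part; case: (\sum_(0 <= m <oo) _)%E => [r|_|/(_ 0%N)]; last 2 first.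
- by rewrite leey.
- by rewrite big_geq.
move=> part; rewrite lee_fin !lerBlDr /expR.
apply: limr_le; first exact: is_cvg_series_exp_coeff.
near=> n; have n2 : (2 <= n)%N by near: n; exact: nbhs_infty_ge.
rewrite -(subnKC n2) add2n; move: (n - 2)%N => k.
rewrite seriesEord/= !big_ord_recl/= /exp_coeff/=.
rewrite fact0 expr0 divr1 expr1 divr1; set S := bigop.body _ _ _.
suff : S <= r by lra.
have := part k; rewrite sumEFin lee_fin big_mkord; apply: le_trans.
apply: ler_sum => i _; rewrite /bump /= !add1n ler_wpM2r//.
by rewrite (le_trans (ler_norm _))// normrX.
Unshelve. all: end_near. Qed.

Lemma nneseries_geometric_le (c q : R) : 0 <= c -> 0 <= q < 1 ->
  (\sum_(0 <= m <oo) (c * q ^+ m)%:E <= (c / (1 - q))%:E)%E.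
Proof.
move=> c0 /andP[q0 q1]; apply: lime_le.
  by apply: is_cvg_nneseries => m _ _; rewrite lee_fin mulr_ge0// exprn_ge0.
apply: nearW => k; rewrite sumEFin lee_fin.
have := congr1 (fun u => u k) (geometric_seriesE c (negbT (lt_eqF q1))).
rewrite /series /= => ->; rewrite ler_pM2r ?invr_gt0 ?subr_gt0//.
by rewrite ler_piMr// gerBl exprn_ge0.
Qed.

Context d (T : measurableType d) (P : probability T R).

(** In the Taylor expansion of [expR (l * X)] the linear term has mean zero and the moment bounds
    turn the remainder into a geometric series of ratio [|l| * kappa]; then [1 + u <= expR u]. *)
Lemma bernstein_mgf (X : {RV P >-> R}) (kappa v l : R) :
  0 < kappa -> 0 < v -> ('E_P[X] = 0)%E ->
  (forall m, (2 <= m)%N -> ('E_P[(fun w => (`|X w| ^+ m)%R)] <=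
     (v * m`!%:R * kappa ^+ (m - 2) / 2)%:E)%E) ->
  `|l| * kappa < 1 ->
  (\int[P]_w (expR (l * X w))%:E <=
   (expR (l ^+ 2 * v / (2 * (1 - `|l| * kappa))))%:E)%E.
Proof.
move=> k0 v0 EX0 EX l1.
have mX : measurable_fun setT X by [].
have mabs m : measurable_fun setT (fun w => `|X w| ^+ m).
  by apply: measurable_funX; exact: measurableT_comp.
have EabsX m : (\int[P]_w (`|X w| ^+ m.+2)%:E <=
    (v * m.+2`!%:R * kappa ^+ m / 2)%:E)%E.
  by have := EX m.+2 isT; rewrite unlock subSS subn1.
have iX : P.-integrable setT (EFin \o X).
  have i1 : P.-integrable setT (EFin \o cst (1 : R)).
    exact: finite_measure_integrable_cst.
  have i2 : P.-integrable setT (EFin \o (fun w => `|X w| ^+ 2)).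
    apply/integrableP; split; first exact/measurable_EFinP.
    under eq_integral do rewrite /= ger0_norm//.
    by rewrite (le_lt_trans (EabsX 0%N))// ltry.
  (* [|X|] is dominated by [1 + |X| ^+ 2], so the second moment gives integrability. *)
  apply: le_integrable (integrableD _ i1 i2) => //.
    exact/measurable_EFinP.
  move=> w _; rewrite /= lee_fin [leRHS]ger0_norm ?addr_ge0//.
  have := sqr_ge0 (`|X w| - 1); rewrite sqrrB1; have := normr_ge0 (X w); lra.
pose h w := expR (l * X w) - 1 - l * X w.
have h0 w : 0 <= h w by rewrite /h -addrA -opprD subr_ge0 expR_ge1Dx.
have mlX : measurable_fun setT (fun w => l * X w).
  exact: measurable_funM.
have mh : measurable_fun setT h.
  apply: measurable_funB => //; apply: measurable_funB => //.
  exact: measurableT_comp.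
set q := `|l| * kappa in l1 *.
have q0 : 0 <= q by rewrite mulr_ge0// ltW.
have Eh : (\int[P]_w (h w)%:E <= (l ^+ 2 * v / (2 * (1 - q)))%:E)%E.
  pose g (m : nat) w := (`|l * X w| ^+ m.+2 / m.+2`!%:R)%:E.
  have g0 m w : (0 <= g m w)%E by rewrite lee_fin divr_ge0.
  have mg m : measurable_fun setT (g m).
    apply/measurable_EFinP; apply: measurable_funM => //.
    by apply: measurable_funX; exact: measurableT_comp.
  apply: (@le_trans _ _ (\int[P]_w (\sum_(0 <= m <oo) g m w))%E).
    apply: ge0_le_integral => //.
    - by move=> w _; rewrite lee_fin.
    - exact/measurable_EFinP.
    - exact: ge0_emeasurable_sum.
    - by move=> w _; exact: expR_taylor2_le.
  rewrite integral_nneseries//.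
  (* The factorial in the moment bound cancels the Taylor denominator. *)
  apply: (@le_trans _ _ (\sum_(0 <= m <oo) (l ^+ 2 * v / 2 * q ^+ m)%:E)%E).
    apply: lee_nneseries => [m _ _|m _]; first exact: integral_ge0.
    rewrite (_ : g m = fun w => ((`|l| ^+ m.+2 / m.+2`!%:R)%:E
                                 * (`|X w| ^+ m.+2)%:E)%E); last first.
      by apply/funext => w; rewrite /g -EFinM normrM exprMn mulrAC.
    rewrite ge0_integralZl//; last exact/measurable_EFinP.
    apply: le_trans (lee_wpmul2l _ (EabsX m)) _; first by rewrite lee_fin divr_ge0.
    rewrite -EFinM lee_fin le_eqVlt; apply/orP; left; apply/eqP.
    rewrite /q exprMn -addn2 exprD real_normK ?num_real// addn2.
    by field; rewrite pnatr_eq0 -lt0n fact_gt0.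
  have c0 : 0 <= l ^+ 2 * v / 2 by rewrite divr_ge0// mulr_ge0 ?sqr_ge0// ltW.
  have q01 : 0 <= q < 1 by rewrite q0.
  by rewrite invfM [X in (X%:E)%E]mulrA; exact: nneseries_geometric_le.
have ih : P.-integrable setT (EFin \o h).
  apply/integrableP; split; first exact/measurable_EFinP.
  under eq_integral do rewrite /= ger0_norm//.
  by rewrite (le_lt_trans Eh)// ltry.
under eq_integral => w _.
  rewrite (_ : expR _ = h w + (1 + l * X w)); last by rewrite /h; ring.
  rewrite EFinD [X in (_ + X)%E]EFinD [X in (_ + (_ + X))%E]EFinM; over.
have i1 : P.-integrable setT (cst 1%E).
  exact: (finite_measure_integrable_cst P 1).
have ilX := integrableZl measurableT l iX.
rewrite integralD//; last exact: integrableD.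
rewrite integralD// integralZl//.
have := integral_cst P measurableT 1%E; rewrite /= probability_setT mule1 => ->.
move: EX0; rewrite unlock => ->; rewrite mule0 adde0.
apply: le_trans (leeD2r _ Eh) _.
by rewrite -EFinD lee_fin addrC expR_ge1Dx.
Qed.
End bernstein_mgf.

(** * Stopped partial sums *)

Section stopped_sums.
Context {R : realType} d (T : measurableType d) (P : probability T R).

(* The event C is carried along so that independence from the later variables can
   be propagated through the stopping recursion. *)
Lemma pair_law_restr (X Y : {RV P >-> R}) (C : set T) (mC : measurable C) :
  (forall A B, measurable A -> measurable B ->
    P (X @^-1` A `&` (Y @^-1` B `&` C)) = P (X @^-1` A) * P (Y @^-1` B) * P C)%E ->
  forall D : set (R * R), measurable D ->
    P ((fun w => (X w, Y w)) @^-1` D `&` C) =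
    ((distribution P X \x distribution P Y) D * P C)%E.
Proof.
move=> rect D mD.
have mXY : measurable_fun setT (fun w => (X w, Y w)).
  exact: measurable_fun_pair.
pose XY : {mfun T >-> (R * R)%type} := mfun_Sub (mem_set mXY).
have PCfin : P C \is a fin_num by exact: fin_num_measure.
have c0 : 0 <= fine (P C) by exact: fine_ge0.
pose c : {nonneg R} := NngNum c0.
have cE : c%:num%:E = P C by rewrite /= fineK.
have scaleY B : mscale c (distribution P Y) B = (P C * P (Y @^-1` B))%E.
  by rewrite -cE.
have scaleXY E : mscale c (distribution P X \x distribution P Y)%E E =
    (P C * (distribution P X \x distribution P Y) E)%E.
  by rewrite -cE.
have -> : P ((fun w => (X w, Y w)) @^-1` D `&` C) = pushforward (mrestr P mC) XY D.
  by [].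
(* Rectangles determine a product measure. The factor [P C] is absorbed into the second marginal, so
   that the restricted law is itself a product, and is then pulled out. *)
transitivity ((distribution P X \x mscale c (distribution P Y))%E D).
  apply/esym; apply: product_measure_unique => // A B mA mB.
  transitivity (P (X @^-1` A `&` (Y @^-1` B `&` C))).
    by rewrite /pushforward /mrestr setIA.
  by rewrite rect// -muleA [X in (_ * X)%E]muleC -scaleY.
transitivity (mscale c (distribution P X \x distribution P Y)%E D).
  apply: product_measure_unique => // A B mA mB.
  by rewrite [LHS]scaleXY product_measure1E// muleCA -scaleY.
by rewrite [LHS]scaleXY muleC.
Qed.

(** [p] pairs the current sum with the next noise variable. A sum outside [[-x, x]] is frozen. *)
Definition stop_step (x : R) (p : R * R) : R :=
  if x < `|p.1| then p.1 else p.1 + p.2.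

Lemma measurable_stop_step x : measurable_fun setT (stop_step x).
Proof.
apply: measurable_fun_ifT => //.
- apply: measurable_fun_ltr => //; exact: measurableT_comp.
- exact: measurable_funD.
Qed.

Fixpoint stopped_sum (e : nat -> {RV P >-> R}) (x : R) (k : nat) (w : T) : R :=
  if k is k'.+1 then stop_step x (stopped_sum e x k' w, e k' w) else 0.

Lemma measurable_stopped_sum e x k : measurable_fun setT (stopped_sum e x k).
Proof.
elim: k => [|k IH]; first exact: measurable_cst.
apply: (measurableT_comp (measurable_stop_step x)).
exact: measurable_fun_pair.
Qed.

HB.instance Definition _ e x k := isMeasurableFun.Build _ _ _ _
  (stopped_sum e x k) (measurable_stopped_sum e x k).

(** A sum that has left [[-x, x]] stays frozen outside, so being inside at time [k] means that no
    stop has occurred: the final time sees the whole maximum. *)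
Lemma stopped_sumP (e : nat -> {RV P >-> R}) x k w : `|stopped_sum e x k w| <= x ->
  stopped_sum e x k w = \sum_(i < k) e i w /\
  forall j, (j <= k)%N -> `|\sum_(i < j) e i w| <= x.
Proof.
elim: k => [|k IH] /=.
  rewrite normr0 big_ord0 => x0; split=> // j; rewrite leqn0 => /eqP->.
  by rewrite big_ord0 normr0.
rewrite /stop_step /=; case: ltP => [lt le|le le'].
  by have := lt_le_trans lt le; rewrite ltxx.
have [sE sP] := IH le; rewrite big_ord_recr /= -sE; split=> // j.
rewrite leq_eqVlt => /predU1P[->|]; last exact: sP.
by rewrite big_ord_recr /= -sE.
Qed.

(** Subfamilies are covered by taking [setT] for the remaining indices. *)
Definition independent_prefix (e : nat -> {RV P >-> R}) (n : nat) :=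
  forall B : nat -> set R, (forall i, measurable (B i)) ->
    P (\bigcap_(i in [set i | (i < n)%N]) e i @^-1` B i) =
    (\prod_(0 <= i < n) P (e i @^-1` B i))%E.

Section independence.
Variables (e : nat -> {RV P >-> R}) (x : R) (n : nat).
Hypothesis indep : independent_prefix e n.

Let tail k (B : nat -> set R) : set T :=
  \bigcap_(i in [set i | (k <= i < n)%N]) e i @^-1` B i.

Let tail_recl k B : (k < n)%N -> tail k B = e k @^-1` B k `&` tail k.+1 B.
Proof.
move=> kn; apply/seteqP; split=> w.
  by move=> tw; split=> [|i /= /andP[ki iN]]; apply: tw; rewrite /= ?leqnn// ltnW.
move=> [ekw tw] i /= /andP[]; rewrite leq_eqVlt => /predU1P[<-//|ki iN].
by apply: tw; rewrite /= ki.
Qed.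

Let tailT k : tail k (fun _ => setT) = setT.
Proof. by apply/seteqP; split=> // w _ i _. Qed.

Let measurable_preimage (X : {RV P >-> R}) A : measurable A ->
  measurable (X @^-1` A).
Proof. by move=> mA; rewrite -[X in measurable X]setTI; exact: measurable_funPT. Qed.

Let measurable_tail k B : (forall i, measurable (B i)) -> measurable (tail k B).
Proof.
by move=> mB; apply: bigcap_measurableType => i _; exact: measurable_preimage.
Qed.

Let indep_at k := forall (A : set R) (B : nat -> set R), measurable A ->
  (forall i, measurable (B i)) ->
  P (stopped_sum e x k @^-1` A `&` tail k B) =
  (P (stopped_sum e x k @^-1` A) * \prod_(k <= i < n) P (e i @^-1` B i))%E.

(** Splits the next variable off the tail event, which gives the rectangle hypothesis of
    [pair_law_restr] with the later variables as [C]. *)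
Let rect_of_indep k : (k < n)%N -> indep_at k ->
  forall B, (forall i, measurable (B i)) ->
  P (tail k.+1 B) = (\prod_(k.+1 <= i < n) P (e i @^-1` B i))%E /\
  forall A B', measurable A -> measurable B' ->
    P (stopped_sum e x k @^-1` A `&` (e k @^-1` B' `&` tail k.+1 B)) =
    (P (stopped_sum e x k @^-1` A) * P (e k @^-1` B') * P (tail k.+1 B))%E.
Proof.
move=> kn ik B mB.
have tailE A B' : measurable A -> measurable B' ->
    P (stopped_sum e x k @^-1` A `&` (e k @^-1` B' `&` tail k.+1 B)) =
    (P (stopped_sum e x k @^-1` A) * (P (e k @^-1` B') *
      \prod_(k.+1 <= i < n) P (e i @^-1` B i)))%E.
  move=> mA mB'; pose B1 i := if i == k then B' else B i.
  have B1E i : (k < i)%N -> B1 i = B i by move=> ki; rewrite /B1 gtn_eqF.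
  have mB1 i : measurable (B1 i) by rewrite /B1; case: ifP.
  have := ik A B1 mA mB1; rewrite tail_recl// big_ltn// {1 3}/B1 eqxx => ikE.
  rewrite (_ : tail k.+1 B = tail k.+1 B1); last first.
    by apply: eq_bigcapr => i /= /andP[ki _]; rewrite B1E.
  rewrite [LHS]ikE; congr (_ * (_ * _))%E.
  by apply: eq_big_nat => i /andP[ki _]; rewrite B1E.
(* Taking both other sets to be [setT] isolates the tail. *)
have PtailE : P (tail k.+1 B) = (\prod_(k.+1 <= i < n) P (e i @^-1` B i))%E.
  have := tailE setT setT measurableT measurableT.
  by rewrite !preimage_setT !setTI probability_setT !mul1e.
by split=> // A B' mA mB'; rewrite tailE// PtailE muleA.
Qed.

Lemma stopped_sum_indep k : (k <= n)%N -> indep_at k.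
Proof.
elim: k => [_ A B mA mB|k IH kn A B mA mB].
  (* At time 0 the stopped sum is the constant 0, so its events are trivial. *)
  rewrite /tail -indep//; have [A0|A0] := pselect (A 0).
    rewrite (_ : _ @^-1` A = setT) ?setTI ?probability_setT ?mul1e//.
    by apply/seteqP; split.
  rewrite (_ : _ @^-1` A = set0) ?set0I ?measure0 ?mul0e//.
  by apply/seteqP; split.
have ik := IH (ltnW kn); have [PtailE rect] := rect_of_indep kn ik mB.
have [_ rectT] := rect_of_indep kn ik (fun _ => measurableT).
pose D := stop_step x @^-1` A.
have mD : measurable D.
  by rewrite -[D]setTI; exact: measurable_stop_step.
(* The pair law is used with the tail event and with the trivial one. The latter identifies the law
   of the next stopped sum, so the former becomes a product. *)
have EC := pair_law_restr (measurable_tail k.+1 mB) rect mD.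
have := pair_law_restr (measurable_tail k.+1 (fun _ => measurableT)) rectT mD.
rewrite tailT setIT probability_setT mule1 => ET.
by rewrite [LHS]EC -ET PtailE.
Qed.

Lemma stopped_sum_pair_law k : (k < n)%N ->
  forall D : set (R * R), measurable D ->
    P ((fun w => (stopped_sum e x k w, e k w)) @^-1` D) =
    (distribution P (stopped_sum e x k) \x distribution P (e k))%E D.
Proof.
move=> kn D mD.
have := pair_law_restr (measurable_tail k.+1 (fun _ => measurableT))
  (rect_of_indep kn (stopped_sum_indep (ltnW kn)) (fun _ => measurableT)).2 mD.
by rewrite tailT setIT probability_setT mule1.
Qed.

End independence.
End stopped_sums.

(** * The maximal inequality *)

Section maximal_inequality.
Context {R : realType} d (T : measurableType d) (P : probability T R).
Variables (e : nat -> {RV P >-> R}) (x : R) (n : nat).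
Hypothesis indep : independent_prefix e n.

(** The stopped sum and the next variable have a product law, so Tonelli integrates the noise first,
    with the sum fixed at a value [s]. *)
Lemma stopped_sum_mgf_step (l M : R) k : (k < n)%N -> 1 <= M ->
  (\int[P]_w (expR (l * e k w))%:E <= M%:E)%E ->
  (\int[P]_w (expR (l * stopped_sum e x k.+1 w))%:E <=
   M%:E * \int[P]_w (expR (l * stopped_sum e x k w))%:E)%E.
Proof.
move=> kn M1 EM.
have M0 : 0 <= M by rewrite (le_trans ler01).
pose S := stopped_sum e x k.
have mpair : measurable_fun setT (fun w => (S w, e k w)).
  exact: measurable_fun_pair.
pose F (p : R * R) := (expR (l * stop_step x p))%:E.
have mexp (f : R * R -> R) : measurable_fun setT f ->
    measurable_fun setT (fun p => (expR (l * f p))%:E).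
  move=> mf; apply/measurable_EFinP; apply: (measurableT_comp (@measurable_expR R)).
  exact: measurable_funM.
have mF : measurable_fun setT F by apply: mexp; exact: measurable_stop_step.
have mexp1 : measurable_fun setT (fun s : R => (expR (l * s))%:E).
  apply/measurable_EFinP; apply: (measurableT_comp (@measurable_expR R)).
  exact: measurable_funM.
pose XY : {mfun T >-> (R * R)%type} := mfun_Sub (mem_set mpair).
have -> : (\int[P]_w (expR (l * stopped_sum e x k.+1 w))%:E =
           \int[pushforward P XY]_p F p)%E.
  by rewrite ge0_integral_pushforward// => p _; rewrite lee_fin expR_ge0.
rewrite (@eq_measure_integral _ _ R setT
  (distribution P S \x distribution P (e k))%E); last first.
  by move=> D mD _; have H := stopped_sum_pair_law x indep kn mD; exact: H.
rewrite fubini_tonelli1//; last by move=> p; rewrite lee_fin expR_ge0.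
rewrite -(@ge0_integral_distribution _ _ _ _ _ P S (fun s => (expR (l * s))%:E))//.
rewrite -ge0_integralZl//.
apply: ge0_le_integral => //.
- by move=> s _; apply: integral_ge0 => u _; rewrite lee_fin expR_ge0.
- by apply: measurable_fun_fubini_tonelli_F => // p; rewrite lee_fin expR_ge0.
- exact: measurable_funeM.
move=> s _; rewrite /fubini_F.
have mFs : measurable_fun setT (fun u => F (s, u)).
  by apply: measurableT_comp mF _; exact: measurable_fun_pair.
rewrite (@ge0_integral_distribution _ _ _ _ _ P (e k) (fun u => F (s, u)))//;
  last by move=> u; rewrite lee_fin expR_ge0.
(* If stopped, the inner integrand is constant and [1 <= M] suffices; otherwise the exponential
   factors and the noise contributes at most [M]. *)
rewrite /F /stop_step /comp /=; case: ltP => _.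
  have := integral_cst P measurableT (expR (l * s))%:E.
  rewrite /= probability_setT mule1 => ->.
  by rewrite -EFinM lee_fin ler_peMl// expR_ge0.
under eq_integral do rewrite mulrDr expRD EFinM.
have me : measurable_fun setT (fun w => (expR (l * e k w))%:E).
  apply/measurable_EFinP; apply: (measurableT_comp (@measurable_expR R)).
  exact: measurable_funM.
rewrite (ge0_integralZl _ measurableT me).
- by rewrite muleC lee_wpmul2r// lee_fin expR_ge0.
- by move=> w _; rewrite lee_fin expR_ge0.
- by rewrite lee_fin expR_ge0.
Qed.

Lemma stopped_sum_mgf (l M : R) : 1 <= M ->
  (forall k, (k < n)%N -> (\int[P]_w (expR (l * e k w))%:E <= M%:E)%E) ->
  forall k, (k <= n)%N ->
  (\int[P]_w (expR (l * stopped_sum e x k w))%:E <= (M ^+ k)%:E)%E.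
Proof.
move=> M1 EM; elim=> [_|k IH kn].
  have := integral_cst P measurableT 1%E.
  by rewrite /= mulr0 expR0 probability_setT mule1 => ->.
apply: le_trans (stopped_sum_mgf_step kn M1 (EM k kn)) _.
rewrite exprS EFinM lee_wpmul2l ?lee_fin ?(le_trans ler01)//.
by apply: IH; exact: ltnW.
Qed.

(** Chernoff's bound for the stopped sum and for its negative, whose exponential moment at [l] is
    that of the sum at [- l]; the two tails give the factor 2. *)
Lemma maximal_chernoff (l M : R) : 0 < l -> 1 <= M ->
  (forall k, (k < n)%N -> (\int[P]_w (expR (l * e k w))%:E <= M%:E)%E) ->
  (forall k, (k < n)%N -> (\int[P]_w (expR (- l * e k w))%:E <= M%:E)%E) ->
  (P [set w | (x < `|stopped_sum e x n w|)%R] <=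
   (2 * (M ^+ n * expR (- (l * x))))%:E)%E.
Proof.
move=> l0 M1 EM EMN.
pose S : {RV P >-> R} := stopped_sum e x n.
pose NS : {RV P >-> R} := (- S)%R.
have mle (X : {RV P >-> R}) : measurable [set w | (x <= X w)%R].
  rewrite -[X in measurable X]setTI; apply: measurable_fun_ler => //.
have sub : [set w | (x < `|S w|)%R] `<=`
    [set w | (x <= S w)%R] `|` [set w | (x <= NS w)%R].
  move=> w /=; rewrite lter_normr => /orP[/ltW ?|/ltW ?]; [by left|by right].
apply: le_trans (le_measure _ _ _ sub) _; rewrite ?inE.
- rewrite -[X in measurable X]setTI; apply: measurable_fun_ltr => //.
  exact: measurableT_comp.
- exact: measurableU.
apply: le_trans (measureU2 _ _ _) _ => //.
rewrite mulr_natl mulr2n EFinD; apply: leeD.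
  apply: le_trans (chernoff S x l0) _.
  rewrite EFinM lee_wpmul2r ?lee_fin ?expR_ge0// /mmt_gen_fun unlock /=.
  apply: le_trans (stopped_sum_mgf M1 EM (leqnn n)).
  by under eq_integral do rewrite mulrC.
apply: le_trans (chernoff NS x l0) _.
rewrite EFinM lee_wpmul2r ?lee_fin ?expR_ge0// /mmt_gen_fun unlock /=.
apply: le_trans (stopped_sum_mgf M1 EMN (leqnn n)).
rewrite le_eqVlt; apply/orP; left; apply/eqP; apply: eq_integral => w _.
by congr (expR _)%:E; rewrite [RHS]mulNr -[RHS]mulrN [RHS]mulrC.
Qed.
End maximal_inequality.

(** * Measurability of Lipschitz functions of random vectors *)

(** By the Lipschitz bound and density of rational vectors, a sublevel set of [F] is a countable
    union of sublevel sets of the functions [F r + \sum_i |r i - Y i|]. *)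
Lemma lipschitz_measurable (R : realType) d (T : measurableType d) n
    (F : ('I_n -> R) -> R) (Y : 'I_n -> T -> R) :
  (forall y z, `|F y - F z| <= \sum_i `|y i - z i|) ->
  (forall i, measurable_fun setT (Y i)) ->
  measurable_fun setT (fun w => F (Y ^~ w)).
Proof.
move=> lipF mY mD; apply: (measurability _ (RGenInftyO.measurableE R)) => //.
move=> _ [_ [c ->] <-]; rewrite setTI.
pose r (q : {ffun 'I_n -> rat}) i : R := ratr (q i).
have -> : (fun w => F (Y ^~ w)) @^-1` `]-oo, c[%classic =
    \bigcup_q [set w | F (r q) + \sum_i `|r q i - Y i w| < c].
  apply/seteqP; split=> w /=; rewrite in_itv/=; last first.
    case=> q _ /=; apply: le_lt_trans.
    by have := lipF (Y ^~ w) (r q); rewrite ler_norml => /andP[_];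
      rewrite lerBlDl; under eq_bigr do rewrite distrC.
  (* The l1-error is spent twice, so it must stay below half of the gap to [c]; [n.+1] leaves strict
     room and is nonzero even for [n = 0]. *)
  move=> Fc; pose s : R := (c - F (Y ^~ w)) / (2 * n.+1%:R).
  have s0 : 0 < s by rewrite divr_gt0 ?subr_gt0// mulr_gt0.
  have ex i : exists q : rat, `|ratr q - Y i w| < s.
    have Ys : Y i w < Y i w + s by rewrite ltrDl.
    have [q] := rat_in_itvoo Ys.
    rewrite in_itv /= => /andP[Yq qY]; exists q.
    by rewrite gtr0_norm ?subr_gt0// ltrBlDl.
  have [q qY] := choice ex; exists [ffun i => q i] => //=.
  have rE i : `|r [ffun i => q i] i - Y i w| < s by rewrite /r ffunE.
  set S := \sum_i _.
  have S_le : S <= n%:R * s.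
    rewrite -[n in n%:R]card_ord mulr_natl -sumr_const.
    by apply: ler_sum => i _; exact: ltW.
  have Fr : F (r [ffun i => q i]) <= S + F (Y ^~ w).
    rewrite -lerBlDr; exact: le_trans (ler_norm _) (lipF _ _).
  have sE : n%:R * s + s = (c - F (Y ^~ w)) / 2.
    by rewrite /s -natr1; field; rewrite addrC natr1 pnatr_eq0.
  rewrite (le_lt_trans (lerD Fr (lexx S)))//; lra.
apply: countable_bigcupT_measurable => [|q]; first exact: countableP.
rewrite -[X in measurable X]setTI; apply: measurable_fun_ltr => //.
apply: measurable_funD => //; apply: measurable_sum => i.
by apply: measurableT_comp => //; exact: measurable_funB.
Qed.

(** * Bernstein's maximal inequality at level alpha *)

(** With [x = n * tau], [N = n * v] and [D = N + kappa * x], the choice [l = x / D] turns the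
    exponent into [- x ^+ 2 / (2 * D)], and [tau] is calibrated to make this [ln (alpha / 2)]. *)
Lemma bernstein_exponent (R : realType) (n : nat) (kappa v alpha : R) :
  (0 < n)%N -> 0 < alpha < 1 -> 0 < kappa -> 0 < v ->
  exists2 l : R, 0 < l /\ l * kappa < 1 &
   2 * (expR (l ^+ 2 * v / (2 * (1 - l * kappa))) ^+ n *
        expR (- (l * (n%:R * tau n kappa v alpha)))) = alpha.
Proof.
move=> n0 /andP[a0 a1] k0 v0.
pose L := - ln (alpha / 2).
have L0 : 0 < L by rewrite oppr_gt0 ln_lt0// divr_gt0//= ltr_pdivrMr//; lra.
have nR0 : 0 < n%:R :> R by rewrite ltr0n.
pose N := n%:R * v; have N0 : 0 < N by exact: mulr_gt0.
set x := n%:R * tau n kappa v alpha.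
have xE : x = Num.sqrt (L * (L * kappa ^+ 2 + 2 * N)) + kappa * L.
  have lnE : ln (alpha / 2) = - L by rewrite opprK.
  rewrite /x /tau mulVKf ?gt_eqF// lnE.
  by congr (Num.sqrt _ + _); rewrite /N; ring.
clearbody x.
have arg0 : 0 <= L * (L * kappa ^+ 2 + 2 * N).
  by rewrite mulr_ge0 ?addr_ge0 ?mulr_ge0 ?sqr_ge0 ?ltW.
have x0 : 0 < x by rewrite xE ltr_wpDl ?sqrtr_ge0// mulr_gt0.
(* n * tau is the positive root of this equation. *)
have sq : x ^+ 2 = 2 * L * (N + kappa * x).
  have : (x - kappa * L) ^+ 2 = L * (L * kappa ^+ 2 + 2 * N).
    by rewrite xE addrK sqr_sqrtr.
  rewrite sqrrB exprMn => E.
  have {E} : x ^+ 2 = L * (L * kappa ^+ 2 + 2 * N) - kappa ^+ 2 * L ^+ 2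
      + x * (kappa * L) *+ 2 by rewrite -E; ring.
  by move=> ->; ring.
pose D := N + kappa * x.
have D0 : 0 < D by rewrite addr_gt0// mulr_gt0.
exists (x / D).
  split; first exact: divr_gt0.
  by rewrite mulrAC ltr_pdivrMr// mul1r mulrC ltrDr.
rewrite -expRM_natl -expRD.
rewrite (_ : _ + _ = ln (alpha / 2)).
  by rewrite lnK ?posrE ?divr_gt0// mulrC divfK.
have xD : 1 - x / D * kappa = N / D by rewrite /D; field; rewrite gt_eqF.
rewrite xD -[RHS]opprK -/L.
have -> : L = x ^+ 2 / (2 * D) by rewrite sq -/D; field; rewrite gt_eqF.
by rewrite /N; field; rewrite !gt_eqF.
Qed.

Lemma independent_prefix_inord (R : realType) d (T : measurableType d)
    (P : probability T R) n (eps : 'I_n.+1 -> {RV P >-> R}) :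
  mutually_independent P eps ->
  independent_prefix (fun k => eps (inord k)) n.+1.
Proof.
move=> ind B mB.
have := ind [set: 'I_n.+1]%SET (fun i => B i) (fun i => mB i).
rewrite big_mkord => E.
rewrite (_ : \bigcap_(i in _) _ =
    \bigcap_(i in [set` [set: 'I_n.+1]%SET]) (eps i @^-1` B i)).
  rewrite E; apply: eq_big => [i|i _]; first by rewrite inE.
  by rewrite inord_val.
apply/seteqP; split=> w H i /=.
  by move=> _; have := H i (ltn_ord i); rewrite /= inord_val.
by move=> iN; have := H (inord i); rewrite /= finset.in_setT inordK//; apply.
Qed.

(** The good event [G] says that the stopped sum ends inside [[-x, x]]. It depends on the noise
    alone. *)
Lemma maximal_bernstein (R : realType) n (alpha : R) d (T : measurableType d)
    (P : probability T R) (eps : 'I_n -> {RV P >-> R}) (kappa v : R) :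
  (0 < n)%N -> 0 < alpha < 1 -> mutually_independent P eps ->
  (forall i, ('E_P[eps i] = 0)%E) -> 0 < kappa -> 0 < v ->
  (forall (m : nat) (i : 'I_n), (2 <= m)%N ->
     ('E_P[(fun w => (`|eps i w| ^+ m)%R)] <=
      (v * m`!%:R * kappa ^+ (m - 2) / 2)%:E)%E) ->
  exists G : set T, [/\ measurable G, ((1 - alpha)%:E <= P G)%E &
    forall w, G w -> forall k, (k <= n)%N ->
      `|\sum_(i < n | (i < k)%N) eps i w| <= n%:R * tau n kappa v alpha].
Proof.
case: n eps => // n eps n0 alpha01 ind mean0 k0 v0 moments.
have [l [l0 lk] lE] := bernstein_exponent n0 alpha01 k0 v0.
set x := n.+1%:R * _ in lE *; set M := expR _ in lE.
pose e k := eps (inord k).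
have M1 : 1 <= M.
  rewrite -expR0 ler_expR divr_ge0 ?mulr_ge0 ?sqr_ge0 ?subr_ge0//; exact: ltW.
have mgf (k : nat) l' : `|l'| = l ->
    (\int[P]_w (expR (l' * e k w))%:E <= M%:E)%E.
  move=> l'E; rewrite /M -l'E real_normK ?num_real//.
  apply: (bernstein_mgf k0 v0 (mean0 _) (fun m => moments m (inord k))).
  by rewrite l'E.
pose bad : set T := [set w | x < `|stopped_sum e x n.+1 w|].
have mbad : measurable bad.
  rewrite -[X in measurable X]setTI; apply: measurable_fun_ltr => //.
  exact: measurableT_comp.
have Pbad : (P bad <= alpha%:E)%E.
  rewrite -lE; apply: maximal_chernoff => //.
  - exact: independent_prefix_inord.
  - by move=> k _; apply: mgf; rewrite gtr0_norm.
  - by move=> k _; apply: mgf; rewrite normrN gtr0_norm.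
exists (~` bad); split; first exact: measurableC.
  by rewrite probability_setC// EFinB leeB.
move=> w /negP; rewrite -leNgt => /stopped_sumP[_ sP] k kn.
apply: le_trans (sP k kn); rewrite le_eqVlt; apply/orP; left; apply/eqP.
rewrite (big_ord_widen _ (fun i => e i w) kn).
by congr `|_|; apply: eq_bigr => i _; rewrite /e inord_val.
Qed.

(** * Simultaneous coverage of the modal distances *)

Theorem theorem2 (R : realType) (X : set (R -> R)) (hX : X `<=` calL)
    (n : nat) (hn : (1 <= n)%N) (alpha : R) (halpha : 0 < alpha < 1)
    (d : measure_display) (T : measurableType d) (P : probability T R)
    (eps : 'I_n -> {RV P >-> R}) (eps_indep : mutually_independent P eps)
    (eps_mean : forall i, ('E_P[eps i] = 0)%E)
    (kappa v : R) (hkappa : 0 < kappa) (hv : 0 < v)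
    (eps_moments : forall (m : nat) (i : 'I_n), (2 <= m)%N ->
       ('E_P[(fun w => (`|eps i w| ^+ m)%R)] <=
        (v * m`!%:R * kappa ^+ (m - 2) / 2)%:E)%E) :
  ((1 - alpha)%:E <=
   ereal_inf
     [set P [set w | (forall j : nat,
        let fn := pc_fun (fun i : 'I_n => f (i%:R / n%:R)) in
        let Yn := pc_fun (fun i : 'I_n => f (i%:R / n%:R) + eps i w) in
        let sY := modal_dist n j Yn in
        modal_dist n j fn \in
          `[Num.max 0 (sY - tau n kappa v alpha), sY + tau n kappa v alpha])%R]
     | f in X])%E.
Proof.
have [G [mG PG GP]] :=
  maximal_bernstein hn halpha eps_indep eps_mean hkappa hv eps_moments.
have nR0 : 0 < n%:R :> R by rewrite ltr0n.
(* The same [G] serves for every [f], so the bound passes to the infimum. *)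
apply/ereal_infP => _ [f _ <-]; apply: (le_trans PG).
pose y (i : 'I_n) := f (i%:R / n%:R).
pose sY j w := modal_dist n j (pc_fun (fun i => y i + eps i w)).
have msY j : measurable_fun setT (sY j).
  apply: (lipschitz_measurable (F := fun z => modal_dist n j (pc_fun z))
    (Y := fun i w => y i + eps i w)) => [u z|i]; last exact: measurable_funD.
  have uz k : (k <= n)%N ->
      `|\sum_(i < n | (i < k)%N) (u i - z i)| <= \sum_i `|u i - z i|.
    move=> _; rewrite (le_trans (ler_norm_sum _ _ _))//.
    by rewrite [leRHS](bigID (fun i : 'I_n => (i < k)%N)) lerDl sumr_ge0.
  (* The Lipschitz constant for the l1-distance is [1 / n], hence at most 1. *)
  apply: le_trans (modal_dist_close j hn uz) _.
  by rewrite ler_piMr ?sumr_ge0// invf_le1// ler1n.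
apply: le_measure; rewrite ?inE//.
  set t := tau n kappa v alpha; pose a j := modal_dist n j (pc_fun y).
  rewrite (_ : mkset _ = \bigcap_j ([set w | Num.max 0 (sY j w - t) <= a j]
                                    `&` [set w | a j <= sY j w + t])); last first.
    apply/seteqP; split=> w H j.
      by move=> _; have := H j; rewrite /= in_itv /= => /andP[].
    by have [] := H j I; rewrite /= in_itv/= => H1 H2; apply/andP.
  apply: bigcapT_measurable => j; apply: measurableI.
    rewrite -[X in measurable X]setTI; apply: measurable_fun_ler => //.
    by apply: measurable_maxr => //; exact: measurable_funB.
  rewrite -[X in measurable X]setTI; apply: measurable_fun_ler => //.
  exact: measurable_funD.
move=> w Gw j /=.
have close : `|modal_dist n j (pc_fun y) - sY j w| <= tau n kappa v alpha.
  have step k : (k <= n)%N ->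
      `|\sum_(i < n | (i < k)%N) (y i - (y i + eps i w))|
      <= n%:R * tau n kappa v alpha.
    move=> kn; apply: le_trans (GP w Gw k kn).
    by under eq_bigr do rewrite opprD addNKr; rewrite sumrN normrN.
  by have := modal_dist_close j hn step; rewrite mulrC mulKf ?gt_eqF.
(* Nonnegativity of the modal distance permits cutting the lower limit off at 0. *)
rewrite in_itv /= ge_max (modal_dist_ge0 j hn (pc_fun_cell_values y)) /=.
by move: close; rewrite ler_distl => /andP[-> ->].
Qed.
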